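(* Let $A\cup\{\varphi\}$ be a finite set of formulas of $\mathcal{L}$. If $A\vdash_{\mathsf{IntCK}}\varphi$, then the nested sequent $A^\bullet,\varphi^\circ$ (where $A^\bullet=\{\gamma^\bullet\mid\gamma\in A\}$) is derivable in $\mathsf{N.IntCK}$.
   Context: Language $\mathcal{L}$: formulas $\varphi ::= p \mid \bot \mid \varphi\wedge\varphi \mid \varphi\vee\varphi \mid \varphi\to\varphi \mid \varphi \mathrel{\Box\!\!\to} \varphi \mid \varphi \mathrel{\Diamond\!\!\to}\varphi$; $\neg\varphi:=\varphi\to\bot$, $\top:=\neg\bot$, $\varphi\leftrightarrow\psi:=(\varphi\to\psi)\wedge(\psi\to\varphi)$. Hilbert system $\mathsf{IntCK}$: any axiomatisation of intuitionistic propositional logic in $\mathcal{L}$ with modus ponens, plus rules RA$_\Box$: from $\varphi\leftrightarrow\rho$ infer $(\varphi\mathrel{\Box\!\!\to}\psi)\leftrightarrow(\rho\mathrel{\Box\!\!\to}\psi)$; RC$_\Box$: from $\psi\leftrightarrow\chi$ infer $(\varphi\mathrel{\Box\!\!\to}\psi)\leftrightarrow(\varphi\mathrel{\Box\!\!\to}\chi)$; RA$_\Diamond$, RC$_\Diamond$: the same with $\mathrel{\Diamond\!\!\to}$; axioms CM$_\Box$: $(\varphi\mathrel{\Box\!\!\to}\psi\wedge\chi)\to(\varphi\mathrel{\Box\!\!\to}\psi)\wedge(\varphi\mathrel{\Box\!\!\to}\chi)$; CC$_\Box$: $(\varphi\mathrel{\Box\!\!\to}\psi)\wedge(\varphi\mathrel{\Box\!\!\to}\chi)\to(\varphi\mathrel{\Box\!\!\to}\psi\wedge\chi)$;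 CN$_\Box$: $\varphi\mathrel{\Box\!\!\to}\top$; CM$_\Diamond$: $(\varphi\mathrel{\Diamond\!\!\to}\psi)\vee(\varphi\mathrel{\Diamond\!\!\to}\chi)\to(\varphi\mathrel{\Diamond\!\!\to}\psi\vee\chi)$; CC$_\Diamond$: $(\varphi\mathrel{\Diamond\!\!\to}\psi\vee\chi)\to(\varphi\mathrel{\Diamond\!\!\to}\psi)\vee(\varphi\mathrel{\Diamond\!\!\to}\chi)$; CN$_\Diamond$: $\neg(\varphi\mathrel{\Diamond\!\!\to}\bot)$; CW: $(\varphi\mathrel{\Diamond\!\!\to}\psi)\wedge(\varphi\mathrel{\Box\!\!\to}\chi)\to(\varphi\mathrel{\Diamond\!\!\to}\psi\wedge\chi)$; CFS: $((\varphi\mathrel{\Diamond\!\!\to}\psi)\to(\varphi\mathrel{\Box\!\!\to}\chi))\to(\varphi\mathrel{\Box\!\!\to}(\psi\to\chi))$. $A\vdash_{\mathsf{IntCK}}\varphi$ means there are $\psi_1,\dots,\psi_n\in A$ with $\psi_1\wedge\dots\wedge\psi_n\to\varphi$ derivable in $\mathsf{IntCK}$. Nested sequents: each formula $\varphi$ gets an input polarity $\varphi^\bullet$ or output polarity $\varphi^\circ$. Input sequents $\Lambda ::= \emptyset \mid \Lambda,\varphi^\bullet \mid \Lambda,[\psi:\Lambda]$ and nested sequents $\Gamma ::= \Lambda,\varphi^\circ \mid \Lambda,[\psi:\Gamma]$, where the index $\psi$ of a component $[\psi:\cdot]$ is an unpolarised formula (commas associative and commutative). A context $\Gamma\{\ \}$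 is a sequent with one hole $\{\ \}$ (possibly inside nested components); rules are applied only when premisses and conclusion are nested sequents. $\Gamma^{\downarrow}\{\ \}$ denotes $\Gamma\{\ \}$ with its output formula removed. Rules of $\mathsf{N.IntCK}$ (premisses / conclusion): init: $\Gamma\{p^\bullet,p^\circ\}$ ($p$ atom, no premiss); $\bot^\bullet$: $\Gamma\{\bot^\bullet\}$ (no premiss); $\wedge^\bullet$: $\Gamma\{\varphi^\bullet,\psi^\bullet\}$ / $\Gamma\{(\varphi\wedge\psi)^\bullet\}$; $\wedge^\circ$: $\Gamma\{\varphi^\circ\}$, $\Gamma\{\psi^\circ\}$ / $\Gamma\{(\varphi\wedge\psi)^\circ\}$; $\vee^\bullet$: $\Gamma\{\varphi^\bullet\}$, $\Gamma\{\psi^\bullet\}$ / $\Gamma\{(\varphi\vee\psi)^\bullet\}$; $\vee^\circ$: $\Gamma\{\varphi^\circ\}$ / $\Gamma\{(\varphi\vee\psi)^\circ\}$ and $\Gamma\{\psi^\circ\}$ / $\Gamma\{(\varphi\vee\psi)^\circ\}$; $\to^\bullet$: $\Gamma^\downarrow\{(\varphi\to\psi)^\bullet,\varphi^\circ\}$, $\Gamma\{\psi^\bullet\}$ / $\Gamma\{(\varphi\to\psi)^\bullet\}$; $\to^\circ$: $\Gamma\{\varphi^\bullet,\psi^\circ\}$ / $\Gamma\{(\varphi\to\psi)^\circ\}$; $\Box^\bullet$: $\varphi^\bullet,\eta^\circ$ and $\eta^\bullet,\varphi^\circ$ and $\Gamma\{(\varphi\mathrel{\Box\!\!\to}\psi)^\bullet,[\eta:\psi^\bullet,\Delta]\}$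 / $\Gamma\{(\varphi\mathrel{\Box\!\!\to}\psi)^\bullet,[\eta:\Delta]\}$; $\Box^\circ$: $\Gamma\{[\varphi:\psi^\circ]\}$ / $\Gamma\{(\varphi\mathrel{\Box\!\!\to}\psi)^\circ\}$; $\Diamond^\bullet$: $\Gamma\{[\varphi:\psi^\bullet]\}$ / $\Gamma\{(\varphi\mathrel{\Diamond\!\!\to}\psi)^\bullet\}$; $\Diamond^\circ$: $\varphi^\bullet,\eta^\circ$ and $\eta^\bullet,\varphi^\circ$ and $\Gamma\{[\eta:\psi^\circ,\Delta]\}$ / $\Gamma\{(\varphi\mathrel{\Diamond\!\!\to}\psi)^\circ,[\eta:\Delta]\}$. A derivation is a finite tree of rule instances whose leaves are instances of init or $\bot^\bullet$. *)

(* Defs.v *)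
From Stdlib Require Import List Permutation.
Import ListNotations.

Inductive formula : Type :=
| Var  : nat -> formula
| Bot  : formula
| And  : formula -> formula -> formula
| Or   : formula -> formula -> formula
| Imp  : formula -> formula -> formula
| CBox : formula -> formula -> formula
| CDia : formula -> formula -> formula.

Definition Neg (p : formula) : formula := Imp p Bot.
Definition Top : formula := Neg Bot.
Definition Iff (p q : formula) : formula := And (Imp p q) (Imp q p).

Inductive prov : formula -> Prop :=
| ax_K   p q   : prov (Imp p (Imp q p))
| ax_S   p q r : prov (Imp (Imp p (Imp q r)) (Imp (Imp p q) (Imp p r)))
| ax_AE1 p q   : prov (Imp (And p q) p)
| ax_AE2 p q   : prov (Imp (And p q) q)
| ax_AI  p q   : prov (Imp p (Imp q (And p q)))
| ax_OI1 p q   : prov (Imp p (Or p q))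
| ax_OI2 p q   : prov (Imp q (Or p q))
| ax_OE  p q r : prov (Imp (Imp p r) (Imp (Imp q r) (Imp (Or p q) r)))
| ax_EFQ p     : prov (Imp Bot p)
| r_MP   p q   : prov (Imp p q) -> prov p -> prov q
| r_RA_box p r q : prov (Iff p r) -> prov (Iff (CBox p q) (CBox r q))
| r_RC_box p q r : prov (Iff q r) -> prov (Iff (CBox p q) (CBox p r))
| r_RA_dia p r q : prov (Iff p r) -> prov (Iff (CDia p q) (CDia r q))
| r_RC_dia p q r : prov (Iff q r) -> prov (Iff (CDia p q) (CDia p r))
| ax_CM_box p q r : prov (Imp (CBox p (And q r)) (And (CBox p q) (CBox p r)))
| ax_CC_box p q r : prov (Imp (And (CBox p q) (CBox p r)) (CBox p (And q r)))
| ax_CN_box p     : prov (CBox p Top)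
| ax_CM_dia p q r : prov (Imp (Or (CDia p q) (CDia p r)) (CDia p (Or q r)))
| ax_CC_dia p q r : prov (Imp (CDia p (Or q r)) (Or (CDia p q) (CDia p r)))
| ax_CN_dia p     : prov (Neg (CDia p Bot))
| ax_CW  p q r : prov (Imp (And (CDia p q) (CBox p r)) (CDia p (And q r)))
| ax_CFS p q r : prov (Imp (Imp (CDia p q) (CBox p r)) (CBox p (Imp q r))).

Fixpoint bigAnd (l : list formula) : formula :=
  match l with
  | [] => Top
  | [x] => x
  | x :: l' => And x (bigAnd l')
  end.

Definition derives (A : list formula) (phi : formula) : Prop :=
  exists l : list formula, incl l A /\ prov (Imp (bigAnd l) phi).

(* A sequent is a list of items (commas taken modulo permutation, see seq_eq). *)
Inductive item : Type :=
| IIn  : formula -> item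
| IOut : formula -> item
| INest : formula -> list item -> item.

Definition sequent := list item.

Fixpoint item_outs (i : item) : nat :=
  match i with
  | IIn _ => 0
  | IOut _ => 1
  | INest _ l =>
      (fix go (l : list item) : nat :=
         match l with [] => 0 | x :: l' => item_outs x + go l' end) l
  end.
Fixpoint outs (l : sequent) : nat :=
  match l with [] => 0 | x :: l' => item_outs x + outs l' end.

(* Input sequents have no output formula; nested sequents (Gamma ::= Lambda,phi°
   | Lambda,[psi:Gamma]) have exactly one output formula in total. *)
Definition is_input (l : sequent) : Prop := outs l = 0.
Definition is_nested (l : sequent) : Prop := outs l = 1.

Fixpoint item_strip (i : item) : list item :=
  match i with
  | IIn f => [IIn f]
  | IOut _ => []
  | INest f l =>
      [INest f ((fix go (l : list item) : list item :=
                   match l with [] => [] | x :: l' => item_strip x ++ go l' end) l)]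
  end.
Fixpoint strip (l : sequent) : sequent :=
  match l with [] => [] | x :: l' => item_strip x ++ strip l' end.

Inductive ieq : item -> item -> Prop :=
| ieq_in f : ieq (IIn f) (IIn f)
| ieq_out f : ieq (IOut f) (IOut f)
| ieq_nest f l1 l l2 :
    Permutation l1 l -> Forall2 ieq l l2 -> ieq (INest f l1) (INest f l2).

Definition seq_eq (l1 l2 : sequent) : Prop :=
  exists l, Permutation l1 l /\ Forall2 ieq l l2.

Inductive ctx : Type :=
| CHole : sequent -> ctx
| CNest : sequent -> formula -> ctx -> ctx.

Fixpoint fill (c : ctx) (d : sequent) : sequent :=
  match c with
  | CHole l => l ++ d
  | CNest l f c' => l ++ [INest f (fill c' d)]
  end.

Fixpoint ctx_down (c : ctx) : ctx :=
  match c with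
  | CHole l => CHole (strip l)
  | CNest l f c' => CNest (strip l) f (ctx_down c')
  end.

Inductive nder : sequent -> Prop :=
| n_init G c p :
    seq_eq G (fill c [IIn (Var p); IOut (Var p)]) -> is_nested G -> nder G
| n_bot G c :
    seq_eq G (fill c [IIn Bot]) -> is_nested G -> nder G
| n_and_in G c f g :
    seq_eq G (fill c [IIn (And f g)]) -> is_nested G ->
    is_nested (fill c [IIn f; IIn g]) -> nder (fill c [IIn f; IIn g]) -> nder G
| n_and_out G c f g :
    seq_eq G (fill c [IOut (And f g)]) -> is_nested G ->
    is_nested (fill c [IOut f]) -> nder (fill c [IOut f]) ->
    is_nested (fill c [IOut g]) -> nder (fill c [IOut g]) -> nder G
| n_or_in G c f g :
    seq_eq G (fill c [IIn (Or f g)]) -> is_nested G ->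
    is_nested (fill c [IIn f]) -> nder (fill c [IIn f]) ->
    is_nested (fill c [IIn g]) -> nder (fill c [IIn g]) -> nder G
| n_or_out1 G c f g :
    seq_eq G (fill c [IOut (Or f g)]) -> is_nested G ->
    is_nested (fill c [IOut f]) -> nder (fill c [IOut f]) -> nder G
| n_or_out2 G c f g :
    seq_eq G (fill c [IOut (Or f g)]) -> is_nested G ->
    is_nested (fill c [IOut g]) -> nder (fill c [IOut g]) -> nder G
| n_imp_in G c f g :
    seq_eq G (fill c [IIn (Imp f g)]) -> is_nested G ->
    is_nested (fill (ctx_down c) [IIn (Imp f g); IOut f]) ->
    nder (fill (ctx_down c) [IIn (Imp f g); IOut f]) ->
    is_nested (fill c [IIn g]) -> nder (fill c [IIn g]) -> nder G
| n_imp_out G c f g :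
    seq_eq G (fill c [IOut (Imp f g)]) -> is_nested G ->
    is_nested (fill c [IIn f; IOut g]) -> nder (fill c [IIn f; IOut g]) -> nder G
| n_box_in G c f g e D :
    seq_eq G (fill c [IIn (CBox f g); INest e D]) -> is_nested G ->
    nder [IIn f; IOut e] -> nder [IIn e; IOut f] ->
    is_nested (fill c [IIn (CBox f g); INest e (IIn g :: D)]) ->
    nder (fill c [IIn (CBox f g); INest e (IIn g :: D)]) -> nder G
| n_box_out G c f g :
    seq_eq G (fill c [IOut (CBox f g)]) -> is_nested G ->
    is_nested (fill c [INest f [IOut g]]) -> nder (fill c [INest f [IOut g]]) ->
    nder G
| n_dia_in G c f g :
    seq_eq G (fill c [IIn (CDia f g)]) -> is_nested G ->
    is_nested (fill c [INest f [IIn g]]) -> nder (fill c [INest f [IIn g]]) ->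
    nder G
| n_dia_out G c f g e D :
    seq_eq G (fill c [IOut (CDia f g); INest e D]) -> is_nested G ->
    nder [IIn f; IOut e] -> nder [IIn e; IOut f] ->
    is_nested (fill c [INest e (IOut g :: D)]) ->
    nder (fill c [INest e (IOut g :: D)]) -> nder G.

(* Main.v *)
Require Import Defs.
From Stdlib Require Import List Permutation PeanoNat Lia.
Import ListNotations.

(** Cut-free completeness without a syntactic cut elimination. Worlds are the input
    nested sequents seen as trees, ordered by adding or decomposing material, and truth at
    a node is defined in continuation-passing style: a disjunction holds when every output
    formula, at any node of the tree, that is cut-free derivable from each extension
    satisfying a disjunct is already cut-free derivable. All axioms and rules of IntCK are
    valid in this structure, and truth at a node is sandwiched between the presence of the
    formula as input there and its derivability as output there, so validity yields a
    cut-free derivation. *)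

(** * Equality of sequents up to permutation at every depth *)

Lemma item_nested_ind (P : item -> Prop)
  (Hin : forall f, P (IIn f)) (Hout : forall f, P (IOut f))
  (Hnest : forall f l, Forall P l -> P (INest f l)) :
  forall i, P i.
Proof.
  fix IH 1. intros [f|f|f l]; [apply Hin|apply Hout|].
  apply Hnest. induction l as [|i l IHl]; constructor; [apply IH|exact IHl].
Qed.

Lemma Forall2_refl_on (R : item -> item -> Prop) l :
  Forall (fun i => R i i) l -> Forall2 R l l.
Proof. induction 1; constructor; auto. Qed.

Lemma ieq_refl i : ieq i i.
Proof.
  induction i as [f|f|f l IH] using item_nested_ind; try constructor.
  apply ieq_nest with l; [reflexivity|]. now apply Forall2_refl_on.
Qed.

(** Symmetry is assumed only for members of [l], the form in which [item_nested_ind] supplies its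
    induction hypothesis. *)
Lemma Forall2_flip_on (R : item -> item -> Prop) l m :
  Forall (fun i => forall j, R i j -> R j i) l -> Forall2 R l m -> Forall2 R m l.
Proof.
  intros H1 H2. induction H2; inversion H1; subst; constructor; auto.
Qed.

Lemma Forall2_trans_on (R : item -> item -> Prop) l m n :
  Forall (fun j => forall i k, R i j -> R j k -> R i k) m ->
  Forall2 R l m -> Forall2 R m n -> Forall2 R l n.
Proof.
  intros H H1; revert n. induction H1; intros n H2; inversion H2; inversion H; subst;
    constructor; eauto.
Qed.

(** [ieq] permutes first and compares entrywise afterwards. Reversing or composing such steps
    requires moving a permutation from the right of the entrywise relation to its left. *)
Lemma Forall2_Permutation_r (R : item -> item -> Prop) l m m' :
  Forall2 R l m -> Permutation m m' -> exists l', Permutation l l' /\ Forall2 R l' m'.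
Proof.
  intros H P. apply Forall2_flip in H.
  destruct (Permutation_Forall2 P H) as [l' [P' H']].
  exists l'. split; [exact P'|]. now apply Forall2_flip.
Qed.

Lemma ieq_sym i j : ieq i j -> ieq j i.
Proof.
  revert j; induction i as [f|f|f l1 IH] using item_nested_ind; intros j H;
    inversion H as [| |g la l l2 P F]; subst; try constructor.
  assert (F' : Forall2 ieq l2 l).
  { apply Forall2_flip_on; [|exact F]. exact (Permutation_Forall P IH). }
  destruct (Forall2_Permutation_r _ _ _ _ F' (Permutation_sym P)) as [m [P' F'']].
  now apply ieq_nest with m.
Qed.

Lemma ieq_trans i j k : ieq i j -> ieq j k -> ieq i k.
Proof.
  revert i k; induction j as [f|f|f l2 IH] using item_nested_ind; intros i k H1 H2;
    inversion H1 as [| |g l1 l la P F]; inversion H2 as [| |g' lb m l3 P' F']; subst;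
    try constructor.
  destruct (Forall2_Permutation_r _ _ _ _ F P') as [n [Pn Fn]].
  apply ieq_nest with n; [now transitivity l|].
  apply Forall2_trans_on with m; auto. exact (Permutation_Forall P' IH).
Qed.

Lemma seq_eq_perm l m : Permutation l m -> seq_eq l m.
Proof.
  intros P. exists m. split; [exact P|]. apply Forall2_refl_on.
  apply Forall_forall; intros; apply ieq_refl.
Qed.

Lemma seq_eq_sym l m : seq_eq l m -> seq_eq m l.
Proof.
  intros [n [P F]].
  assert (F' : Forall2 ieq m n).
  { apply Forall2_flip_on; [|exact F]. apply Forall_forall; intros; now apply ieq_sym. }
  destruct (Forall2_Permutation_r _ _ _ _ F' (Permutation_sym P)) as [k [P' F'']].
  now exists k.
Qed.

Lemma seq_eq_trans l m n : seq_eq l m -> seq_eq m n -> seq_eq l n.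
Proof.
  intros [l' [P F]] [m' [P' F']].
  destruct (Forall2_Permutation_r _ _ _ _ F P') as [k [Pk Fk]].
  exists k. split; [now transitivity l'|].
  apply Forall2_trans_on with m'; auto.
  apply Forall_forall; intros; eapply ieq_trans; eassumption.
Qed.

Lemma seq_eq_app l l' m m' : seq_eq l l' -> seq_eq m m' -> seq_eq (l ++ m) (l' ++ m').
Proof.
  intros [k [P F]] [k' [P' F']]. exists (k ++ k'). split.
  - now apply Permutation_app.
  - now apply Forall2_app.
Qed.

Lemma seq_eq_nest f l m : seq_eq l m -> seq_eq [INest f l] [INest f m].
Proof.
  intros [k [P F]]. exists [INest f l]. split; [reflexivity|].
  constructor; [now apply ieq_nest with k|constructor].
Qed.

Lemma item_outs_nest f l : item_outs (INest f l) = outs l.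
Proof. reflexivity. Qed.

Lemma item_strip_nest f l : item_strip (INest f l) = [INest f (strip l)].
Proof. reflexivity. Qed.

Lemma outs_app l m : outs (l ++ m) = outs l + outs m.
Proof. induction l; simpl; lia. Qed.

Lemma strip_app l m : strip (l ++ m) = strip l ++ strip m.
Proof. induction l; simpl; [easy|]. now rewrite IHl, app_assoc. Qed.

Lemma outs_perm l m : Permutation l m -> outs l = outs m.
Proof. induction 1; simpl; lia. Qed.

Lemma outs_Forall2_on l m :
  Forall (fun i => forall j, ieq i j -> item_outs i = item_outs j) l ->
  Forall2 ieq l m -> outs l = outs m.
Proof.
  intros H F. induction F; [easy|]. inversion H; subst. simpl. f_equal; auto.
Qed.

Lemma ieq_outs i j : ieq i j -> item_outs i = item_outs j.
Proof.
  revert j; induction i as [f|f|f l1 IH] using item_nested_ind; intros j H;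
    inversion H as [| |g la l l2 P F]; subst; try reflexivity.
  rewrite !item_outs_nest. transitivity (outs l); [now apply outs_perm|].
  apply outs_Forall2_on; [|exact F]. exact (Permutation_Forall P IH).
Qed.

Lemma seq_eq_outs l m : seq_eq l m -> outs l = outs m.
Proof.
  intros [k [P F]]. transitivity (outs k); [now apply outs_perm|].
  apply outs_Forall2_on; [|exact F]. apply Forall_forall; intros; now apply ieq_outs.
Qed.

Lemma nder_is_nested G : nder G -> is_nested G.
Proof. now destruct 1. Qed.

(** Every rule of [nder] fixes its conclusion only up to [seq_eq], so the last rule absorbs the
    change and the premisses stay as they are. *)
Lemma nder_seq_eq G H : nder G -> seq_eq G H -> nder H.
Proof.
  intros D E.
  assert (N : is_nested H).
  { unfold is_nested. rewrite <- (seq_eq_outs _ _ E). now apply nder_is_nested. }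
  apply seq_eq_sym in E.
  destruct D.
  - eapply n_init; eauto using seq_eq_trans.
  - eapply n_bot; eauto using seq_eq_trans.
  - eapply n_and_in; eauto using seq_eq_trans.
  - eapply n_and_out; eauto using seq_eq_trans.
  - eapply n_or_in; eauto using seq_eq_trans.
  - eapply n_or_out1; eauto using seq_eq_trans.
  - eapply n_or_out2; eauto using seq_eq_trans.
  - eapply n_imp_in; eauto using seq_eq_trans.
  - eapply n_imp_out; eauto using seq_eq_trans.
  - eapply n_box_in; eauto using seq_eq_trans.
  - eapply n_box_out; eauto using seq_eq_trans.
  - eapply n_dia_in; eauto using seq_eq_trans.
  - eapply n_dia_out; eauto using seq_eq_trans.
Qed.

(** * Tree sequents *)

(** Inputs, outputs and children are kept apart so that a path of child positions names a component
    independently of the formulas around it. *)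
Inductive tree : Type :=
| Node : list formula -> list formula -> list (formula * tree) -> tree.

Definition t_ins (t : tree) := let (A, _, _) := t in A.
Definition t_outs (t : tree) := let (_, B, _) := t in B.
Definition t_kids (t : tree) := let (_, _, C) := t in C.

Lemma tree_nested_ind (P : tree -> Prop)
  (H : forall A B C, Forall (fun p => P (snd p)) C -> P (Node A B C)) :
  forall t, P t.
Proof.
  fix IH 1. intros [A B C]. apply H.
  induction C as [|p C IHC]; constructor; [apply IH|exact IHC].
Qed.

Fixpoint tseq (t : tree) : sequent :=
  match t with
  | Node A B C =>
      map IIn A ++ map IOut B ++ map (fun p => INest (fst p) (tseq (snd p))) C
  end.

Definition nests (C : list (formula * tree)) : sequent :=
  map (fun p => INest (fst p) (tseq (snd p))) C.

(** The counterpart of [strip] on trees; its fixed points, singled out by [wf], represent the input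
    sequents. *)
Fixpoint erase (t : tree) : tree :=
  match t with
  | Node A B C => Node A [] (map (fun p => (fst p, erase (snd p))) C)
  end.

Definition erase_kids (C : list (formula * tree)) :=
  map (fun p => (fst p, erase (snd p))) C.

Lemma tseq_Node A B C : tseq (Node A B C) = map IIn A ++ map IOut B ++ nests C.
Proof. reflexivity. Qed.

Lemma erase_Node A B C : erase (Node A B C) = Node A [] (erase_kids C).
Proof. reflexivity. Qed.

Lemma strip_ins A : strip (map IIn A) = map IIn A.
Proof. induction A; simpl; congruence. Qed.

Lemma strip_outs B : strip (map IOut B) = [].
Proof. induction B; simpl; congruence. Qed.

Lemma outs_ins A : outs (map IIn A) = 0.
Proof. induction A; simpl; congruence. Qed.

Lemma strip_tseq t : strip (tseq t) = tseq (erase t).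
Proof.
  induction t as [A B C IH] using tree_nested_ind.
  rewrite tseq_Node, erase_Node, tseq_Node, !strip_app, strip_ins, strip_outs. simpl.
  f_equal. induction IH as [|[e t] C E _ IHC]; [reflexivity|].
  simpl in *. now rewrite <- E, <- IHC.
Qed.

Lemma strip_nests C : strip (nests C) = nests (erase_kids C).
Proof.
  induction C as [|[e t] C IH]; [reflexivity|]. cbn - [tseq erase item_strip].
  rewrite item_strip_nest, strip_tseq. simpl. now f_equal.
Qed.

Lemma outs_erase t : outs (tseq (erase t)) = 0.
Proof.
  induction t as [A B C IH] using tree_nested_ind.
  rewrite erase_Node, tseq_Node, !outs_app, outs_ins. simpl.
  induction IH as [|[e t] C E _ IHC]; [reflexivity|].
  cbn - [tseq erase item_outs]. rewrite item_outs_nest. simpl in E. now rewrite E.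
Qed.

Lemma nests_app C D : nests (C ++ D) = nests C ++ nests D.
Proof. apply map_app. Qed.

(** * Paths, local updates and contexts *)

Definition path := list nat.

Fixpoint mapnth {T} (n : nat) (F : T -> T) (C : list (formula * T)) :=
  match C, n with
  | [], _ => []
  | (e, t) :: C', 0 => (e, F t) :: C'
  | p :: C', S n' => p :: mapnth n' F C'
  end.

Lemma mapnth_split {T} (C1 C2 : list (formula * T)) e t F :
  mapnth (length C1) F (C1 ++ (e, t) :: C2) = C1 ++ (e, F t) :: C2.
Proof. induction C1 as [|[e' t'] C1 IH]; simpl; congruence. Qed.

Lemma nth_error_mapnth {T} n m F (C : list (formula * T)) e t :
  nth_error C m = Some (e, t) ->
  nth_error (mapnth n F C) m = Some (e, if Nat.eq_dec n m then F t else t).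
Proof.
  revert n m; induction C as [|[e' t'] C IH]; intros n m; destruct n, m; simpl;
    intros H; try discriminate; try (now inversion H); auto.
  rewrite (IH n m H). destruct (Nat.eq_dec n m); destruct (Nat.eq_dec (S n) (S m)); congruence.
Qed.

Lemma mapnth_comm {T} n m (F G : T -> T) C :
  (n = m -> forall e t, nth_error C n = Some (e, t) -> F (G t) = G (F t)) ->
  mapnth n F (mapnth m G C) = mapnth m G (mapnth n F C).
Proof.
  revert n m; induction C as [|[e t] C IH]; intros n m H; destruct n, m; simpl; auto.
  - f_equal. f_equal. now apply (H eq_refl e t).
  - f_equal. apply IH. intros -> e' t' E. now apply (H eq_refl e' t').
Qed.

Lemma mapnth_app {T} n F (C D : list (formula * T)) e t :
  nth_error C n = Some (e, t) -> mapnth n F (C ++ D) = mapnth n F C ++ D.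
Proof.
  revert n; induction C as [|[e' t'] C IH]; intros [|n] H; simpl in *; try discriminate.
  - reflexivity.
  - f_equal. now apply IH.
Qed.

Fixpoint sub (t : tree) (x : path) : option tree :=
  match x with
  | [] => Some t
  | n :: x' => match nth_error (t_kids t) n with
               | Some (_, t') => sub t' x'
               | None => None
               end
  end.

Fixpoint upd (x : path) (f : tree -> tree) (t : tree) : tree :=
  match x with
  | [] => f t
  | n :: x' => let (A, B, C) := t in Node A B (mapnth n (upd x' f) C)
  end.

Definition valid (W : tree) (x : path) := exists u, sub W x = Some u.

Definition ins_at (W : tree) (x : path) : list formula :=
  match sub W x with Some u => t_ins u | None => [] end.

Definition kid (W : tree) (x : path) (n : nat) : option formula :=
  match sub W x with
  | Some u => option_map fst (nth_error (t_kids u) n)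
  | None => None
  end.

Definition wf (W : tree) := erase W = W.

Definition addo (W : tree) (g : path) (c : formula) :=
  upd g (fun u => Node (t_ins u) (c :: t_outs u) (t_kids u)) W.

(** New children go to the end of the list, so that all old paths keep their meaning. *)
Definition setn (W : tree) (x : path) (A' : list formula) (k : list (formula * tree)) :=
  upd x (fun u => Node A' (t_outs u) (t_kids u ++ k)) W.

Lemma nth_error_kids_split t n e t' :
  nth_error (t_kids t) n = Some (e, t') ->
  exists A B C1 C2, t = Node A B (C1 ++ (e, t') :: C2) /\ length C1 = n.
Proof.
  destruct t as [A B C]; simpl. intros H.
  destruct (nth_error_split _ _ H) as (C1 & C2 & -> & L). now exists A, B, C1, C2.
Qed.

(** Permutations of concatenations are solved by splitting off single entries as blocks, rotating
    the right side until its first block matches, and cancelling. *)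
Ltac perm_norm :=
  repeat match goal with
  | |- context [?a :: ?l] =>
      lazymatch l with nil => fail | _ => change (a :: l) with ([a] ++ l) end
  end;
  rewrite ?app_nil_r; rewrite <- ?app_assoc; rewrite ?app_nil_l, ?app_nil_r.
Ltac perm_rotate :=
  match goal with
  | |- Permutation _ (?b ++ ?r) =>
      apply (fun H => Permutation_trans H (Permutation_app_comm r b)); rewrite <- ?app_assoc
  end.
Ltac perm_head :=
  first [ apply Permutation_refl
        | apply Permutation_app_head
        | perm_rotate; first [ apply Permutation_app_head
        | perm_rotate; first [ apply Permutation_app_head
        | perm_rotate; first [ apply Permutation_app_head
        | perm_rotate; first [ apply Permutation_app_head
        | perm_rotate; first [ apply Permutation_app_head
        | perm_rotate; apply Permutation_app_head ]]]]]].
Ltac perm :=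
  perm_norm;
  repeat perm_head;
  try (apply Permutation_app_comm).

(* [l] is what surrounds the principal formulas at the node [x]. *)
Lemma ctx_at t x u l :
  sub t x = Some u ->
  exists c,
    (forall f d, seq_eq (tseq (f u)) (l ++ d) -> seq_eq (tseq (upd x f t)) (fill c d)) /\
    (forall f d, seq_eq (tseq (f (erase u))) (strip l ++ d) ->
                 seq_eq (tseq (upd x f (erase t))) (fill (ctx_down c) d)).
Proof.
  revert t. induction x as [|n x IH]; intros t H; simpl in H.
  - inversion H; subst. exists (CHole l). simpl. auto.
  - destruct (nth_error (t_kids t) n) as [[e t']|] eqn:E; [|discriminate].
    destruct (nth_error_kids_split _ _ _ _ E) as (A & B & C1 & C2 & -> & L).
    destruct (IH t' H) as (c & H1 & H2).
    exists (CNest (map IIn A ++ map IOut B ++ nests C1 ++ nests C2) e c). split.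
    + intros f d Hd. specialize (H1 f d Hd). subst n. cbn [upd].
      rewrite mapnth_split, tseq_Node, nests_app.
      change (nests ((e, upd x f t') :: C2)) with (INest e (tseq (upd x f t')) :: nests C2).
      cbn [fill].
      apply seq_eq_trans
        with ((map IIn A ++ map IOut B ++ nests C1 ++ nests C2) ++ [INest e (tseq (upd x f t'))]).
      * apply seq_eq_perm. perm.
      * apply seq_eq_app; [now apply seq_eq_perm|now apply seq_eq_nest].
    + intros f d Hd. specialize (H2 f d Hd). subst n.
      rewrite erase_Node. unfold erase_kids. rewrite map_app. cbn [upd map fst snd].
      rewrite <- (length_map (fun p => (fst p, erase (snd p))) C1), mapnth_split.
      fold (erase_kids C1) (erase_kids C2).
      rewrite tseq_Node, nests_app. cbn [fill ctx_down].
      change (nests ((e, upd x f (erase t')) :: erase_kids C2))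
        with (INest e (tseq (upd x f (erase t'))) :: nests (erase_kids C2)).
      rewrite !strip_app, strip_ins, strip_outs, !strip_nests.
      apply seq_eq_trans
        with ((map IIn A ++ nests (erase_kids C1) ++ nests (erase_kids C2))
                ++ [INest e (tseq (upd x f (erase t')))]).
      * apply seq_eq_perm. simpl map. perm.
      * apply seq_eq_app; [now apply seq_eq_perm|now apply seq_eq_nest].
Qed.

Lemma sub_app W x p : sub W (x ++ p) = match sub W x with Some u => sub u p | None => None end.
Proof.
  revert W; induction x as [|n x IH]; intros W; simpl; [reflexivity|].
  destruct (nth_error (t_kids W) n) as [[e t]|]; auto.
Qed.

Lemma upd_app x p f W : upd (x ++ p) f W = upd x (upd p f) W.
Proof.
  revert W; induction x as [|n x IH]; intros [A B C]; simpl; [reflexivity|].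
  f_equal. revert n; induction C as [|[e t] C IHC]; intros [|n]; simpl; congruence.
Qed.

Lemma upd_upd x f h W : upd x f (upd x h W) = upd x (fun u => f (h u)) W.
Proof.
  revert W; induction x as [|n x IH]; intros [A B C]; simpl; [reflexivity|].
  f_equal. revert n; induction C as [|[e t] C IHC]; intros [|n]; simpl; congruence.
Qed.

Lemma sub_upd_same x f W u : sub W x = Some u -> sub (upd x f W) x = Some (f u).
Proof.
  revert W; induction x as [|n x IH]; intros [A B C]; simpl; [congruence|].
  destruct (nth_error C n) as [[e t]|] eqn:E; [|discriminate]. intros H.
  rewrite (nth_error_mapnth n n _ _ _ _ E). destruct (Nat.eq_dec n n); [auto|congruence].
Qed.

(** The update keeps the old children as a prefix, so every old path still leads to a node with the
    same indices below it, and inputs can change only at [x]. *)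
Lemma sub_upd x f W y u :
  (forall u, exists k, t_kids (f u) = t_kids u ++ k) ->
  sub W y = Some u ->
  exists u', sub (upd x f W) y = Some u' /\ (x <> y -> t_ins u' = t_ins u) /\
    forall n e t, nth_error (t_kids u) n = Some (e, t) ->
                  exists t', nth_error (t_kids u') n = Some (e, t').
Proof.
  intros Hf. revert W y; induction x as [|n x IH]; intros [A B C] [|m y] H; cbn [sub upd] in *.
  - inversion H; subst. exists (f (Node A B C)). repeat split; [congruence|].
    intros n e t E. destruct (Hf (Node A B C)) as [k ->]. exists t.
    rewrite nth_error_app1; [exact E|]. apply nth_error_Some. congruence.
  - destruct (Hf (Node A B C)) as [k ->]. exists u.
    destruct (nth_error (t_kids (Node A B C)) m) eqn:E; [|discriminate].
    rewrite nth_error_app1, E by (apply nth_error_Some; congruence).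
    repeat split; eauto.
  - inversion H; subst. eexists; repeat split. simpl. intros m e t E. eexists.
    apply (nth_error_mapnth n m _ _ _ _ E).
  - simpl in *. destruct (nth_error C m) as [[e t]|] eqn:E; [|discriminate].
    rewrite (nth_error_mapnth n m _ _ _ _ E). destruct (Nat.eq_dec n m) as [->|N].
    + destruct (IH t y H) as (u' & H1 & H2 & H3). exists u'. repeat split; auto.
      intros N; apply H2; congruence.
    + exists u. repeat split; eauto.
Qed.

(** One update touches outputs, the other inputs and the end of the child list, so they commute even
    at the same node. Validity of [g] in [W] excludes paths into the new children. *)
Lemma addo_setn W x A' k g c :
  valid W g -> addo (setn W x A' k) g c = setn (addo W g c) x A' k.
Proof.
  unfold addo, setn. revert W g; induction x as [|n x IH]; intros [A B C] [|m g] [u H];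
    simpl in *; try reflexivity.
  - destruct (nth_error C m) as [[e t]|] eqn:E; [|discriminate].
    f_equal. now apply mapnth_app with e t.
  - f_equal. apply mapnth_comm. intros -> e t E. rewrite E in H. apply IH. now exists u.
Qed.

Lemma erase_upd x f W :
  (forall u, erase (f u) = f (erase u)) -> erase (upd x f W) = upd x f (erase W).
Proof.
  intros Hf. revert W; induction x as [|n x IH]; intros [A B C]; [apply Hf|].
  cbn [upd]. rewrite !erase_Node. f_equal. revert n.
  induction C as [|[e t] C IHC]; intros [|n]; simpl; try reflexivity.
  - now rewrite IH.
  - f_equal. apply IHC.
Qed.

Lemma erase_addo W g c : erase (addo W g c) = erase W.
Proof.
  unfold addo. revert W; induction g as [|n g IH]; intros [A B C]; [reflexivity|].
  cbn [upd]. rewrite !erase_Node. f_equal. revert n.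
  induction C as [|[e t] C IHC]; intros [|n]; simpl; try reflexivity.
  - now rewrite IH.
  - f_equal. apply IHC.
Qed.

Lemma wf_setn W x A' k : wf W -> erase_kids k = k -> wf (setn W x A' k).
Proof.
  intros H Hk. unfold wf, setn. rewrite erase_upd, H; [reflexivity|].
  intros [A B C]. simpl. f_equal. unfold erase_kids in Hk. now rewrite map_app, Hk.
Qed.

Lemma upd_id x W : upd x (fun u => u) W = W.
Proof.
  revert W; induction x as [|n x IH]; intros [A B C]; simpl; [reflexivity|].
  f_equal. revert n; induction C as [|[e t] C IHC]; intros [|n]; simpl; congruence.
Qed.

(** * Inference rules acting at a node of a tree *)

Lemma outs_addo W g c : valid W g -> outs (tseq (addo W g c)) = S (outs (tseq W)).
Proof.
  unfold addo. revert W; induction g as [|n g IH]; intros W [u H].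
  - destruct W as [A B C]. cbn [upd t_ins t_outs t_kids].
    rewrite !tseq_Node, !outs_app. simpl. lia.
  - simpl in H. destruct (nth_error (t_kids W) n) as [[e t]|] eqn:E; [|discriminate].
    destruct (nth_error_kids_split _ _ _ _ E) as (A & B & C1 & C2 & -> & <-).
    cbn [upd]. rewrite mapnth_split, !tseq_Node, !nests_app, !outs_app.
    cbn - [tseq item_outs upd]. rewrite !item_outs_nest, IH; [lia|now exists u].
Qed.

Lemma is_nested_addo W g c : wf W -> valid W g -> is_nested (tseq (addo W g c)).
Proof.
  intros H V. unfold is_nested. rewrite outs_addo by exact V. f_equal.
  rewrite <- H. apply outs_erase.
Qed.

Lemma sub_addo W g c x u :
  sub W x = Some u -> exists u', sub (addo W g c) x = Some u' /\ t_ins u' = t_ins u.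
Proof.
  intros H. destruct (list_eq_dec Nat.eq_dec g x) as [->|N].
  - eexists. split; [exact (sub_upd_same _ _ _ _ H)|]. reflexivity.
  - destruct (sub_upd g (fun u => Node (t_ins u) (c :: t_outs u) (t_kids u)) W x u)
      as (u' & H1 & H2 & _); auto.
    + intros v. exists []. symmetry. apply app_nil_r.
    + exists u'. auto.
Qed.

(** The hole sits at [x] and all the rest, including [c] wherever [g] lies, is context, so one [G]
    serves the conclusion and the premisses of a left rule. The last clause is for the left
    implication rule, whose first premiss drops [c] and puts a new output at [x]. *)
Lemma left_ctx W x g c phi A0 :
  wf W -> valid W x -> valid W g -> Permutation (ins_at W x) (phi :: A0) ->
  exists G,
    seq_eq (tseq (addo W g c)) (fill G [IIn phi]) /\
    (forall A' k, seq_eq (tseq (addo (setn W x (A' ++ A0) k) g c))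
                         (fill G (map IIn A' ++ nests k))) /\
    (forall psi, seq_eq (tseq (addo W x psi)) (fill (ctx_down G) [IIn phi; IOut psi])).
Proof.
  intros Hwf [u Hu] Hg P. unfold ins_at in P. rewrite Hu in P.
  destruct (sub_addo W g c x u Hu) as (u' & Hu' & E). rewrite <- E in P. clear u Hu E.
  destruct u' as [A B C]. simpl in P.
  assert (P' : Permutation (map IIn A) ([IIn phi] ++ map IIn A0))
    by apply (Permutation_map IIn P).
  destruct (ctx_at _ _ _ (map IIn A0 ++ map IOut B ++ nests C) Hu') as (G & H1 & H2).
  exists G. repeat split.
  - rewrite <- (upd_id x (addo W g c)). apply H1. apply seq_eq_perm.
    rewrite tseq_Node, P'. perm.
  - intros A' k. rewrite addo_setn by assumption. apply H1. apply seq_eq_perm.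
    cbn [t_outs t_kids]. rewrite tseq_Node, map_app, nests_app. perm.
  (* As [W] has no outputs, erasing [addo W g c] gives back [W], which is what [ctx_down G]
     surrounds the hole with. *)
  - intros psi. rewrite <- Hwf, <- (erase_addo W g c). apply H2. apply seq_eq_perm.
    rewrite erase_Node. cbn [t_ins t_outs t_kids].
    rewrite tseq_Node, P', !strip_app, strip_ins, strip_outs, strip_nests. simpl map. perm.
Qed.

Lemma nder_transport G H : nder G -> seq_eq G H -> is_nested H /\ nder H.
Proof.
  intros D E. assert (D' := nder_seq_eq _ _ D E). split; [now apply nder_is_nested|exact D'].
Qed.

Ltac transport H E :=
  let N := fresh "N" in
  destruct (nder_transport _ _ H E) as [N ?]; clear H.

Lemma addo_bot_in W x g c :
  wf W -> valid W x -> valid W g -> In Bot (ins_at W x) -> nder (tseq (addo W g c)).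
Proof.
  intros Hwf Hx Hg Hin. apply Add_inv in Hin as [A0 Hin]. apply Permutation_Add in Hin.
  destruct (left_ctx W x g c _ A0 Hwf Hx Hg (Permutation_sym Hin)) as (G & H1 & _).
  eapply n_bot; [exact H1|now apply is_nested_addo].
Qed.

Lemma addo_and_in W x g c a b A0 :
  wf W -> valid W x -> valid W g -> Permutation (ins_at W x) (And a b :: A0) ->
  nder (tseq (addo (setn W x ([a; b] ++ A0) []) g c)) -> nder (tseq (addo W g c)).
Proof.
  intros Hwf Hx Hg P D. destruct (left_ctx W x g c _ _ Hwf Hx Hg P) as (G & H1 & H2 & _).
  transport D (H2 [a; b] []).
  eapply n_and_in; eauto using is_nested_addo.
Qed.

Lemma addo_or_in W x g c a b A0 :
  wf W -> valid W x -> valid W g -> Permutation (ins_at W x) (Or a b :: A0) ->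
  nder (tseq (addo (setn W x ([a] ++ A0) []) g c)) ->
  nder (tseq (addo (setn W x ([b] ++ A0) []) g c)) -> nder (tseq (addo W g c)).
Proof.
  intros Hwf Hx Hg P D D'. destruct (left_ctx W x g c _ _ Hwf Hx Hg P) as (G & H1 & H2 & _).
  transport D (H2 [a] []). transport D' (H2 [b] []).
  eapply n_or_in; eauto using is_nested_addo.
Qed.

Lemma addo_imp_in W x g c a b A0 :
  wf W -> valid W x -> valid W g -> Permutation (ins_at W x) (Imp a b :: A0) ->
  nder (tseq (addo W x a)) ->
  nder (tseq (addo (setn W x ([b] ++ A0) []) g c)) -> nder (tseq (addo W g c)).
Proof.
  intros Hwf Hx Hg P D D'. destruct (left_ctx W x g c _ _ Hwf Hx Hg P) as (G & H1 & H2 & H3).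
  transport D (H3 a). transport D' (H2 [b] []).
  eapply n_imp_in; eauto using is_nested_addo.
Qed.

Lemma addo_dia_in W x g c a b A0 :
  wf W -> valid W x -> valid W g -> Permutation (ins_at W x) (CDia a b :: A0) ->
  nder (tseq (addo (setn W x ([] ++ A0) [(a, Node [b] [] [])]) g c)) ->
  nder (tseq (addo W g c)).
Proof.
  intros Hwf Hx Hg P D. destruct (left_ctx W x g c _ _ Hwf Hx Hg P) as (G & H1 & H2 & _).
  transport D (H2 [] [(a, Node [b] [] [])]).
  eapply n_dia_in; eauto using is_nested_addo.
Qed.

Lemma kid_valid W x n e : kid W x n = Some e -> valid W x /\ valid W (x ++ [n]).
Proof.
  unfold kid, valid. rewrite sub_app. destruct (sub W x) as [u|]; [|discriminate]. simpl.
  destruct (nth_error (t_kids u) n) as [[e' t]|]; [|discriminate]. eauto.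
Qed.

(** The rule needs the conditional and the child in view together, so the hole is put at the parent
    [x] and the change in the child is recast as an update of [x]. *)
Lemma addo_box_in W x n e g c a b :
  wf W -> valid W g -> In (CBox a b) (ins_at W x) -> kid W x n = Some e ->
  nder [IIn a; IOut e] -> nder [IIn e; IOut a] ->
  nder (tseq (addo (setn W (x ++ [n]) (b :: ins_at W (x ++ [n])) []) g c)) ->
  nder (tseq (addo W g c)).
Proof.
  intros Hwf Hg Hin Hk D1 D2 D3.
  rewrite addo_setn in D3 by assumption. unfold setn in D3. rewrite upd_app in D3.
  unfold ins_at, kid in *. rewrite sub_app in D3.
  destruct (sub W x) as [u|] eqn:Hu; [|discriminate]. simpl in Hk, D3.
  destruct (nth_error (t_kids u) n) as [[e' t]|] eqn:E; [|discriminate].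
  inversion Hk; subst e'. clear Hk.
  assert (Ht : sub W (x ++ [n]) = Some t) by (rewrite sub_app, Hu; simpl; now rewrite E).
  destruct (sub_addo W g c _ _ Ht) as (t' & Ht' & Et). rewrite <- Et in D3.
  destruct (sub_addo W g c _ _ Hu) as (u' & Hu' & Eu). rewrite <- Eu in Hin.
  (* Attaching the output may alter the content of the child, but neither its position nor its
     index. *)
  assert (E' : nth_error (t_kids u') n = Some (e, t')).
  { rewrite sub_app, Hu' in Ht'. simpl in Ht'.
    destruct (sub_upd g (fun u => Node (t_ins u) (c :: t_outs u) (t_kids u)) W x u)
      as (v & H1 & _ & H3); auto.
    { intros v. exists []. symmetry. apply app_nil_r. }
    unfold addo in Hu'. rewrite Hu' in H1. inversion H1; subst v.
    destruct (H3 _ _ _ E) as [t'' E'']. rewrite E'' in *. congruence. }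
  destruct (nth_error_kids_split _ _ _ _ E') as (A & B & C1 & C2 & -> & <-).
  apply in_split in Hin as (A1 & A2 & EA). simpl in EA. subst A.
  destruct t' as [At Bt Ct].
  destruct (ctx_at _ _ _ (map IIn (A1 ++ A2) ++ map IOut B ++ nests (C1 ++ C2)) Hu')
    as (G & H1 & _).
  assert (D3' : seq_eq (tseq (addo W g c))
                  (fill G [IIn (CBox a b); INest e (tseq (Node At Bt Ct))])).
  { rewrite <- (upd_id x (addo W g c)). apply H1. apply seq_eq_perm.
    rewrite tseq_Node, !nests_app, !map_app. cbn - [tseq]. perm. }
  assert (S3 : seq_eq (tseq (upd x (upd [length C1]
             (fun u => Node (b :: At) (t_outs u) (t_kids u ++ []))) (addo W g c)))
             (fill G [IIn (CBox a b); INest e (IIn b :: tseq (Node At Bt Ct))])).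
  { apply H1. apply seq_eq_perm. cbn [upd]. rewrite mapnth_split.
    cbn [t_outs t_kids]. rewrite app_nil_r.
    rewrite tseq_Node, !nests_app, !map_app. cbn - [tseq].
    change (tseq (Node (b :: At) Bt Ct)) with (IIn b :: tseq (Node At Bt Ct)).
    perm. }
  transport D3 S3.
  eapply n_box_in; eauto using is_nested_addo.
Qed.

Lemma addo_var W x p :
  wf W -> valid W x -> In (Var p) (ins_at W x) -> nder (tseq (addo W x (Var p))).
Proof.
  intros Hwf Hx Hin. assert (N := is_nested_addo W x (Var p) Hwf Hx).
  destruct Hx as [[A B C] Hu]. unfold ins_at in Hin. rewrite Hu in Hin.
  apply in_split in Hin as (A1 & A2 & EA). simpl in EA. subst A.
  destruct (ctx_at _ _ _ (map IIn (A1 ++ A2) ++ map IOut B ++ nests C) Hu) as (G & H1 & _).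
  apply n_init with G p; [|exact N]. apply H1. apply seq_eq_perm.
  cbn [t_ins t_outs t_kids]. rewrite tseq_Node, !map_app. simpl map. perm.
Qed.

Lemma right_ctx W x :
  valid W x ->
  exists G,
    (forall c, seq_eq (tseq (addo W x c)) (fill G [IOut c])) /\
    (forall a c, seq_eq (tseq (addo (setn W x (a :: ins_at W x) []) x c))
                        (fill G [IIn a; IOut c])) /\
    (forall k, seq_eq (tseq (setn W x (ins_at W x) k)) (fill G (nests k))).
Proof.
  intros [[A B C] Hu]. unfold ins_at. rewrite Hu. cbn [t_ins].
  destruct (ctx_at _ _ _ (map IIn A ++ map IOut B ++ nests C) Hu) as (G & H1 & _).
  exists G. repeat split.
  - intros c. apply H1. apply seq_eq_perm. cbn [t_ins t_outs t_kids].
    rewrite tseq_Node. simpl map. perm.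
  - intros a c. unfold addo, setn. rewrite upd_upd. apply H1. apply seq_eq_perm.
    cbn [t_ins t_outs t_kids]. rewrite tseq_Node. simpl map. perm.
  - intros k. apply H1. apply seq_eq_perm.
    cbn [t_ins t_outs t_kids]. rewrite tseq_Node, nests_app. perm.
Qed.

Lemma addo_and_out W x a b :
  wf W -> valid W x -> nder (tseq (addo W x a)) -> nder (tseq (addo W x b)) ->
  nder (tseq (addo W x (And a b))).
Proof.
  intros Hwf Hx D D'. destruct (right_ctx W x Hx) as (G & H1 & _).
  transport D (H1 a). transport D' (H1 b).
  eapply n_and_out; eauto using is_nested_addo.
Qed.

Lemma addo_or_out1 W x a b :
  wf W -> valid W x -> nder (tseq (addo W x a)) -> nder (tseq (addo W x (Or a b))).
Proof.
  intros Hwf Hx D. destruct (right_ctx W x Hx) as (G & H1 & _).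
  transport D (H1 a). eapply n_or_out1; eauto using is_nested_addo.
Qed.

Lemma addo_or_out2 W x a b :
  wf W -> valid W x -> nder (tseq (addo W x b)) -> nder (tseq (addo W x (Or a b))).
Proof.
  intros Hwf Hx D. destruct (right_ctx W x Hx) as (G & H1 & _).
  transport D (H1 b). eapply n_or_out2; eauto using is_nested_addo.
Qed.

Lemma addo_imp_out W x a b :
  wf W -> valid W x -> nder (tseq (addo (setn W x (a :: ins_at W x) []) x b)) ->
  nder (tseq (addo W x (Imp a b))).
Proof.
  intros Hwf Hx D. destruct (right_ctx W x Hx) as (G & H1 & H2 & _).
  transport D (H2 a b). eapply n_imp_out; eauto using is_nested_addo.
Qed.

(** The position that the next child appended at [x] will take. *)
Definition nkids (W : tree) (x : path) : nat :=
  match sub W x with Some u => length (t_kids u) | None => 0 end.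

(** The right box rule creates a child together with its output. Worlds carry no outputs, so the
    child is first created empty and [b] is attached at its path. *)
Lemma addo_setn_new W x A' e b :
  valid W x ->
  addo (setn W x A' [(e, Node [] [] [])]) (x ++ [nkids W x]) b =
  setn W x A' [(e, Node [] [b] [])].
Proof.
  unfold nkids, addo, setn. intros [u H]. rewrite H, upd_app, upd_upd.
  revert W H; induction x as [|n x IH]; intros [A B C] H; simpl in *.
  - inversion H; subst. simpl. f_equal.
    apply (mapnth_split C []).
  - destruct (nth_error C n) as [[e' t]|] eqn:E; [|discriminate].
    f_equal. apply nth_error_split in E as (C1 & C2 & -> & <-).
    rewrite !mapnth_split. f_equal. f_equal. f_equal. now apply IH.
Qed.

Lemma addo_box_out W x a b :
  wf W -> valid W x ->
  nder (tseq (addo (setn W x (ins_at W x) [(a, Node [] [] [])]) (x ++ [nkids W x]) b)) ->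
  nder (tseq (addo W x (CBox a b))).
Proof.
  intros Hwf Hx D. destruct (right_ctx W x Hx) as (G & H1 & _ & H3).
  rewrite addo_setn_new in D by assumption.
  transport D (H3 [(a, Node [] [b] [])]). eapply n_box_out; eauto using is_nested_addo.
Qed.

Lemma addo_dia_out W x n e a b :
  wf W -> kid W x n = Some e ->
  nder [IIn a; IOut e] -> nder [IIn e; IOut a] ->
  nder (tseq (addo W (x ++ [n]) b)) -> nder (tseq (addo W x (CDia a b))).
Proof.
  intros Hwf Hk D1 D2 D3. destruct (kid_valid _ _ _ _ Hk) as [Hx _].
  assert (N := is_nested_addo W x (CDia a b) Hwf Hx).
  unfold kid in Hk. destruct Hx as [u Hu]. rewrite Hu in Hk.
  destruct (nth_error (t_kids u) n) as [[e' t]|] eqn:E; [|discriminate].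
  inversion Hk; subst e'. clear Hk.
  destruct (nth_error_kids_split _ _ _ _ E) as (A & B & C1 & C2 & -> & <-).
  destruct (ctx_at _ _ _ (map IIn A ++ map IOut B ++ nests (C1 ++ C2)) Hu) as (G & H1 & _).
  destruct t as [At Bt Ct].
  assert (S3 : seq_eq (tseq (addo W (x ++ [length C1]) b))
             (fill G [INest e (IOut b :: tseq (Node At Bt Ct))])).
  { unfold addo. rewrite upd_app. apply H1. cbn [upd t_ins t_outs t_kids].
    rewrite mapnth_split, tseq_Node, !nests_app.
    cbn - [tseq]. rewrite (tseq_Node At (b :: Bt) Ct), (tseq_Node At Bt Ct).
    apply seq_eq_trans with
      ((map IIn A ++ map IOut B ++ nests C1 ++ nests C2)
         ++ [INest e (map IIn At ++ map IOut (b :: Bt) ++ nests Ct)]).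
    - apply seq_eq_perm. perm.
    - apply seq_eq_app; [now apply seq_eq_perm|]. apply seq_eq_nest, seq_eq_perm.
      simpl map. perm. }
  transport D3 S3.
  apply n_dia_out with G a b e (tseq (Node At Bt Ct)); auto. apply H1. apply seq_eq_perm.
  cbn [t_ins t_outs t_kids]. rewrite tseq_Node, !nests_app. cbn - [tseq]. perm.
Qed.

(** * Extensions of worlds *)

(* The left rules consume their principal formula, so a formula of a world survives
   in an extension only up to decomposition. *)
Fixpoint real (phi : formula) (W : tree) (x : path) : Prop :=
  In phi (ins_at W x) \/
  match phi with
  | And a b => real a W x /\ real b W x
  | Or a b => real a W x \/ real b W x
  | Imp a b => real b W x
  | CDia a b => exists n, kid W x n = Some a /\ real b W (x ++ [n])
  | _ => False
  end.

(** Well-formedness enters as an implication so that [le] is reflexive on all trees. Positions and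
    indices persist exactly because forcing refers to nodes by path. *)
Definition le (W V : tree) : Prop :=
  (wf W -> wf V) /\
  (forall x, valid W x -> valid V x) /\
  (forall x phi, In phi (ins_at W x) -> real phi V x) /\
  (forall x n e, kid W x n = Some e -> kid V x n = Some e).

Lemma real_in phi W x : In phi (ins_at W x) -> real phi W x.
Proof. destruct phi; simpl; auto. Qed.

(** Induction on [phi]: a literal occurrence persists by [le], a decomposed one through its
    components. Transitivity of [le] rests on this. *)
Lemma real_le phi W V x : le W V -> real phi W x -> real phi V x.
Proof.
  intros (_ & _ & L & K). revert x.
  induction phi; intros x [H|H]; auto; try contradiction; right.
  - destruct H; auto.
  - destruct H; auto.
  - auto.
  - destruct H as (n & H1 & H2). eauto.
Qed.

Lemma in_ins_at_valid phi W x : In phi (ins_at W x) -> valid W x.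
Proof. unfold ins_at, valid. destruct (sub W x); [eauto|easy]. Qed.

Lemma real_valid phi W x : real phi W x -> valid W x.
Proof.
  induction phi; intros [H|H]; eauto using in_ins_at_valid; try contradiction.
  - now destruct H; auto.
  - now destruct H; auto.
  - destruct H as (n & H & _). now apply kid_valid in H.
Qed.

Lemma le_refl W : le W W.
Proof. repeat split; auto using real_in. Qed.

Lemma le_trans W V U : le W V -> le V U -> le W U.
Proof.
  intros (H1 & H2 & H3 & H4) L. assert (L' := L). destruct L as (K1 & K2 & K3 & K4).
  repeat split; auto. intros x phi H. eapply real_le; eauto.
Qed.

Lemma setn_extends A' k : forall u, exists k',
  t_kids ((fun u => Node A' (t_outs u) (t_kids u ++ k)) u) = t_kids u ++ k'.
Proof. intros u. now exists k. Qed.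

Lemma ins_at_setn W x A' k : valid W x -> ins_at (setn W x A' k) x = A'.
Proof.
  intros [u H]. unfold ins_at, setn. now rewrite (sub_upd_same _ _ _ _ H).
Qed.

Lemma kid_setn W x A' k y n e : kid W y n = Some e -> kid (setn W x A' k) y n = Some e.
Proof.
  unfold kid. destruct (sub W y) as [u|] eqn:Hu; [|discriminate].
  destruct (nth_error (t_kids u) n) as [[e' t]|] eqn:E; [|discriminate].
  destruct (sub_upd x _ _ _ _ (setn_extends A' k) Hu) as (u' & H1 & _ & H3).
  unfold setn. rewrite H1. destruct (H3 _ _ _ E) as [t' ->]. auto.
Qed.

Lemma sub_setn_new W x A' e t :
  valid W x -> sub (setn W x A' [(e, t)]) (x ++ [nkids W x]) = Some t.
Proof.
  intros [u H]. unfold setn, nkids. rewrite sub_app, (sub_upd_same _ _ _ _ H), H. simpl.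
  rewrite nth_error_app2, Nat.sub_diag by lia. reflexivity.
Qed.

Lemma kid_setn_new W x A' e t :
  valid W x -> kid (setn W x A' [(e, t)]) x (nkids W x) = Some e.
Proof.
  intros [u H]. unfold setn, nkids, kid. rewrite (sub_upd_same _ _ _ _ H), H. simpl.
  rewrite nth_error_app2, Nat.sub_diag by lia. reflexivity.
Qed.

(** Only [x] can lose inputs, so their persistence needs checking there alone; [erase_kids k = k]
    keeps outputs out of the new children. *)
Lemma le_setn W x A' k :
  valid W x -> erase_kids k = k ->
  (forall phi, In phi (ins_at W x) -> real phi (setn W x A' k) x) ->
  le W (setn W x A' k).
Proof.
  intros Hx Hk H. repeat split.
  - intros Hwf. now apply wf_setn.
  - intros y [u Hu]. destruct (sub_upd x _ _ _ _ (setn_extends A' k) Hu) as (u' & H1 & _).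
    now exists u'.
  - intros y phi Hin. destruct (list_eq_dec Nat.eq_dec x y) as [->|N]; [now apply H|].
    apply real_in. unfold ins_at in Hin. destruct (sub W y) as [u|] eqn:Hu; [|easy].
    destruct (sub_upd x _ _ _ _ (setn_extends A' k) Hu) as (u' & H1 & H2 & _).
    unfold ins_at, setn. now rewrite H1, H2.
  - intros y n e. apply kid_setn.
Qed.

Lemma le_setn_split W x A' k phi A0 :
  valid W x -> erase_kids k = k -> Permutation (ins_at W x) (phi :: A0) ->
  real phi (setn W x (A' ++ A0) k) x -> le W (setn W x (A' ++ A0) k).
Proof.
  intros Hx Hk P H. apply le_setn; auto. intros psi Hin.
  apply (Permutation_in _ P) in Hin as [<-|Hin]; [exact H|].
  apply real_in. rewrite ins_at_setn by exact Hx. apply in_or_app. now right.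
Qed.

Lemma le_setn_cons W x phi : valid W x -> le W (setn W x (phi :: ins_at W x) []).
Proof.
  intros Hx. apply le_setn; auto. intros psi Hin. apply real_in.
  rewrite ins_at_setn by exact Hx. now right.
Qed.

Lemma le_setn_kid W x e : valid W x -> le W (setn W x (ins_at W x) [(e, Node [] [] [])]).
Proof.
  intros Hx. apply le_setn; auto. intros psi Hin. apply real_in.
  now rewrite ins_at_setn by exact Hx.
Qed.

(** * The cover modality *)

(* [W] is covered by [P] when, for deriving any output formula at any node, one may
   assume [P]; this is the closure operator that makes disjunction and the diamond
   conditional behave like cut-free provability. *)
Definition cover (P : tree -> Prop) (W : tree) : Prop :=
  forall V g c, le W V -> valid V g ->
    (forall U, le V U -> P U -> nder (tseq (addo U g c))) -> nder (tseq (addo V g c)).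

Lemma cover_le P W V : le W V -> cover P W -> cover P V.
Proof. intros L H U g c L'. apply H. eapply le_trans; eauto. Qed.

(** [cover] is a continuation monad whose answers are cut-free derivations of [c] at [g], made
    stable under extension; this is its unit, and [cover_bind] its bind. *)
Lemma cover_unit (P : tree -> Prop) W : (forall V, le W V -> P V) -> cover P W.
Proof. intros H V g c L Hg K. apply K; auto using le_refl. Qed.

Lemma cover_bind (P Q : tree -> Prop) W :
  cover P W -> (forall V, le W V -> P V -> cover Q V) -> cover Q W.
Proof.
  intros H K V g c L Hg HQ. apply H; auto. intros U L' HP.
  apply (K U) with (V := U); eauto using le_refl, le_trans.
  now apply L'.
Qed.

Lemma in_split_perm (phi : formula) l : In phi l -> exists l0, Permutation l (phi :: l0).
Proof.
  intros H. apply Add_inv in H as [l0 H]. exists l0. symmetry. now apply Permutation_Add.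
Qed.

Lemma cover_bot W x : wf W -> real Bot W x -> cover (fun _ => False) W.
Proof.
  intros Hwf H V g c L Hg K. assert (HV0 := real_le _ _ _ _ L H); clear H; destruct HV0 as [H|[]].
  apply addo_bot_in with x; auto; [now apply L|]. now apply in_ins_at_valid in H.
Qed.

(** The pattern for the left rules: if the formula is already decomposed, the continuation applies
    at once; otherwise the rule is applied backwards and its premiss is an extension in which the
    components are present. *)
Lemma cover_and W x a b :
  wf W -> real (And a b) W x -> cover (fun V => real a V x /\ real b V x) W.
Proof.
  intros Hwf H V g c L Hg K. assert (HV0 := real_le _ _ _ _ L H); clear H; destruct HV0 as [H|H].
  2: { apply K; auto using le_refl. }
  assert (Hx := in_ins_at_valid _ _ _ H). assert (HV : wf V) by now apply L.
  apply in_split_perm in H as [A0 P].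
  apply addo_and_in with x a b A0; auto.
  assert (R : real a (setn V x ([a; b] ++ A0) []) x /\ real b (setn V x ([a; b] ++ A0) []) x).
  { split; apply real_in; rewrite ins_at_setn by exact Hx; simpl; auto. }
  apply K; [|exact R]. apply le_setn_split with (And a b); auto. now right.
Qed.

Lemma cover_or W x a b :
  wf W -> real (Or a b) W x -> cover (fun V => real a V x \/ real b V x) W.
Proof.
  intros Hwf H V g c L Hg K. assert (HV0 := real_le _ _ _ _ L H); clear H; destruct HV0 as [H|H].
  2: { apply K; auto using le_refl. }
  assert (Hx := in_ins_at_valid _ _ _ H). assert (HV : wf V) by now apply L.
  apply in_split_perm in H as [A0 P].
  assert (Ra : real a (setn V x ([a] ++ A0) []) x).
  { apply real_in; rewrite ins_at_setn by exact Hx; simpl; auto. }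
  assert (Rb : real b (setn V x ([b] ++ A0) []) x).
  { apply real_in; rewrite ins_at_setn by exact Hx; simpl; auto. }
  apply addo_or_in with x a b A0; auto; (apply K; [|auto]);
    apply le_setn_split with (Or a b); auto; right; auto.
Qed.

(** Derivability of [a] at [x] supplies the premiss whose output differs from the goal. It is
    assumed in all extensions because the rule is applied at an arbitrary one. *)
Lemma cover_imp W x a b :
  wf W -> real (Imp a b) W x ->
  (forall V, le W V -> nder (tseq (addo V x a))) -> cover (fun V => real b V x) W.
Proof.
  intros Hwf H Ha V g c L Hg K. assert (HV0 := real_le _ _ _ _ L H); clear H; destruct HV0 as [H|H].
  2: { apply K; auto using le_refl. }
  assert (Hx := in_ins_at_valid _ _ _ H). assert (HV : wf V) by now apply L.
  apply in_split_perm in H as [A0 P].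
  assert (Rb : real b (setn V x ([b] ++ A0) []) x).
  { apply real_in; rewrite ins_at_setn by exact Hx; simpl; auto. }
  apply addo_imp_in with x a b A0; auto. apply K; [|auto].
  apply le_setn_split with (Imp a b); auto. now right.
Qed.

Lemma cover_dia W x a b :
  wf W -> real (CDia a b) W x ->
  cover (fun V => exists n, kid V x n = Some a /\ real b V (x ++ [n])) W.
Proof.
  intros Hwf H V g c L Hg K. assert (HV0 := real_le _ _ _ _ L H); clear H; destruct HV0 as [H|H].
  2: { apply K; auto using le_refl. }
  assert (Hx := in_ins_at_valid _ _ _ H). assert (HV : wf V) by now apply L.
  apply in_split_perm in H as [A0 P].
  assert (R : exists n, kid (setn V x ([] ++ A0) [(a, Node [b] [] [])]) x n = Some a /\
                        real b (setn V x ([] ++ A0) [(a, Node [b] [] [])]) (x ++ [n])).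
  (* The witness is the fresh child opened by the left diamond rule. *)
  { exists (nkids V x). split; [now apply kid_setn_new|].
    apply real_in. unfold ins_at. rewrite sub_setn_new by exact Hx. now left. }
  apply addo_dia_in with x a b A0; auto. apply K; [|exact R].
  apply le_setn_split with (CDia a b); auto. right. exact R.
Qed.

Lemma cover_box W x n e a b :
  wf W -> real (CBox a b) W x -> kid W x n = Some e ->
  nder [IIn a; IOut e] -> nder [IIn e; IOut a] ->
  cover (fun V => real b V (x ++ [n])) W.
Proof.
  intros Hwf H Hk D1 D2 V g c L Hg K.
  assert (HV0 := real_le _ _ _ _ L H); clear H; destruct HV0 as [H|[]]. apply L in Hk.
  destruct (kid_valid _ _ _ _ Hk) as [_ Hn]. assert (HV : wf V) by now apply L.
  apply addo_box_in with x n e a b; auto. apply K.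
  - now apply le_setn_cons.
  - apply real_in. rewrite ins_at_setn by exact Hn. now left.
Qed.

(** * Forcing *)

(* The formula [e] indexing a component counts as equivalent to a truth set [P] when
   [P] lies between the cut-free left and right behaviour of [e]. Unlike equality of
   truth sets, this does not mention the truth set of [e], which keeps [force]
   structurally recursive although [e] is arbitrary. *)
Definition agrees (P : tree -> path -> Prop) (e : formula) : Prop :=
  (forall W x, wf W -> real e W x -> P W x) /\
  (forall W x, wf W -> valid W x -> P W x -> nder (tseq (addo W x e))).

(** A Beth-style forcing: [cover] appears only in the clauses not already closed under it. The box
    clause ranges over extensions because suitable children may be added later. *)
Fixpoint force (phi : formula) (W : tree) (x : path) : Prop :=
  match phi with
  | Var p => cover (fun V => real (Var p) V x) W
  | Bot => cover (fun _ => False) W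
  | And a b => force a W x /\ force b W x
  | Or a b => cover (fun V => force a V x \/ force b V x) W
  | Imp a b => forall V, le W V -> force a V x -> force b V x
  | CBox a b => forall V n e, le W V -> kid V x n = Some e -> agrees (force a) e ->
                force b V (x ++ [n])
  | CDia a b => cover (fun V => exists n e, kid V x n = Some e /\ agrees (force a) e /\
                                           force b V (x ++ [n])) W
  end.

Lemma force_le phi W V x : le W V -> force phi W x -> force phi V x.
Proof.
  revert W V x; induction phi; intros W V x L; simpl; eauto using cover_le, le_trans.
  intros []; eauto.
Qed.

(** Clauses that begin with [cover] are closed by bind; conjunction, implication and the box
    conditional inherit closure from their parts. *)
Lemma force_cover phi W x : cover (fun V => force phi V x) W -> force phi W x.
Proof.
  revert W x; induction phi; intros W x H; simpl.
  - eapply cover_bind; [exact H|auto].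
  - eapply cover_bind; [exact H|auto].
  - split; [apply IHphi1|apply IHphi2]; (eapply cover_bind; [exact H|]);
      intros V L HV; apply cover_unit; intros U L';
      apply (force_le _ _ _ _ L') in HV; apply HV.
  - eapply cover_bind; [exact H|auto].
  - intros V L Ha. apply IHphi2. eapply cover_bind; [eapply cover_le; eauto|].
    intros U LU HU. apply cover_unit. intros U' LU'. apply HU; auto.
    eapply force_le; [|exact Ha]. eapply le_trans; eauto.
  - intros V n e L Hk Ha. apply IHphi2. eapply cover_bind; [eapply cover_le; eauto|].
    intros U LU HU. apply cover_unit. intros U' LU'. apply HU with e; auto.
    apply LU', LU, Hk.
  - eapply cover_bind; [exact H|auto].
Qed.

Lemma force_cover_real phi W x :
  (forall V y, wf V -> real phi V y -> force phi V y) ->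
  wf W -> cover (fun V => real phi V x) W -> force phi W x.
Proof.
  intros IH Hwf H. apply force_cover. eapply cover_bind; [exact H|].
  intros V L HV. apply cover_unit. intros U L'. apply IH.
  - apply L', L, Hwf.
  - eapply real_le; eauto.
Qed.

(** Provides the two side premisses of the left box and right diamond rules. On the one-node world
    with input [a], the set [P] holds at the root, hence [e] is derivable there as output; the
    converse is symmetric. *)
Lemma agrees_nder (P : tree -> path -> Prop) e a :
  agrees P e ->
  (forall W x, wf W -> real a W x -> P W x) ->
  (forall W x, wf W -> valid W x -> P W x -> nder (tseq (addo W x a))) ->
  nder [IIn a; IOut e] /\ nder [IIn e; IOut a].
Proof.
  intros [H1 H2] H3 H4. split.
  - apply (H2 (Node [a] [] []) []); [reflexivity|now eexists|].
    apply H3; [reflexivity|]. apply real_in. now left.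
  - apply (H4 (Node [e] [] []) []); [reflexivity|now eexists|].
    apply H1; [reflexivity|]. apply real_in. now left.
Qed.

(** Both halves go in one induction because implication and the conditionals use their antecedent in
    both directions. Reflection comes from the left rules through [cover], reification from the
    right rules. *)
Lemma reflect_reify phi :
  (forall W x, wf W -> real phi W x -> force phi W x) /\
  (forall W x, wf W -> valid W x -> force phi W x -> nder (tseq (addo W x phi))).
Proof.
  induction phi as [p| |a [La Ra] b [Lb Rb]|a [La Ra] b [Lb Rb]|a [La Ra] b [Lb Rb]
                    |a [La Ra] b [Lb Rb]|a [La Ra] b [Lb Rb]]; split; intros W x Hwf.
  - intros H. apply cover_unit. intros V L. eapply real_le; eauto.
  (* The cover is applied to the target sequent itself, with [Var p] as output at [x]; disjunction
     and diamond are reified likewise. *)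
  - intros Hx H. apply H; auto using le_refl. intros U L [HU|[]].
    apply addo_var; auto; now apply L.
  - intros H. now apply cover_bot with x.
  - intros Hx H. apply H; auto using le_refl. contradiction.
  - intros H. apply cover_and in H; auto.
    split; apply force_cover_real; auto; (eapply cover_bind; [exact H|]);
      intros V L []; apply cover_unit; intros; eapply real_le; eauto.
  - intros Hx [H1 H2]. apply addo_and_out; auto.
  - intros H. apply cover_or in H; auto. apply cover_bind with (1 := H).
    intros V L HV. apply cover_unit. intros U L'.
    assert (HU : wf U) by (apply L', L, Hwf).
    destruct HV as [HV|HV]; [left; apply La|right; apply Lb]; auto; eapply real_le; eauto.
  - intros Hx H. apply H; auto using le_refl. intros U L HU.
    assert (wf U) by now apply L. assert (valid U x) by now apply L.
    destruct HU; [apply addo_or_out1|apply addo_or_out2]; auto.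
  - intros H V L Ha. assert (HV : wf V) by now apply L.
    assert (Hx : valid V x) by (apply L; eapply real_valid; eauto).
    apply force_cover_real; auto.
    apply cover_imp with a; auto; [eapply real_le; eauto|].
    intros U L'. apply Ra; [now apply L'|now apply L'|]. eapply force_le; eauto.
  - intros Hx H. apply addo_imp_out; auto.
    (* With [a] added as input at [x], reflection forces [a] there, so [b] is forced and can be
       reified. *)
    assert (L := le_setn_cons W x a Hx).
    assert (wf (setn W x (a :: ins_at W x) [])) by now apply L.
    apply Rb; auto; [now apply L|]. apply H; auto. apply La; auto.
    apply real_in. rewrite ins_at_setn by exact Hx. now left.
  - intros H V n e L Hk Ha. assert (HV : wf V) by now apply L.
    destruct (agrees_nder _ _ _ Ha La Ra) as [D1 D2].
    apply force_cover_real; auto. apply cover_box with e a; auto. eapply real_le; eauto.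
  - intros Hx H. apply addo_box_out; auto.
    assert (L := le_setn_kid W x a Hx).
    apply Rb; [now apply L| |].
    + eexists. now apply sub_setn_new.
    (* The fresh child is indexed by [a] itself, and [agrees (force a) a] is the induction
       hypothesis for [a]. *)
    + apply H with a; auto; [now apply kid_setn_new|now split].
  - intros H. apply cover_dia in H; auto. apply cover_bind with (1 := H).
    intros V L (n & Hk & Hb). apply cover_unit. intros U L'. exists n, a. repeat split; auto.
    + now apply L'.
    + apply Lb; [apply L', L, Hwf|]. eapply real_le; eauto.
  - intros Hx H. apply H; auto using le_refl. intros U L (n & e & Hk & Ha & Hb).
    destruct (agrees_nder _ _ _ Ha La Ra) as [D1 D2].
    assert (HU : wf U) by now apply L.
    apply addo_dia_out with n e; auto. apply Rb; auto. now apply kid_valid in Hk.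
Qed.

(** * Validity of the axioms and rules of IntCK *)

Lemma agrees_iff P Q e : (forall W x, P W x <-> Q W x) -> agrees P e -> agrees Q e.
Proof. intros H [H1 H2]. split; intros; [apply H|apply H2]; auto; now apply H. Qed.

Lemma force_Iff a b :
  (forall W x, force (Iff a b) W x) -> forall W x, force a W x <-> force b W x.
Proof. intros H W x. destruct (H W x) as [H1 H2]. split; [apply H1|apply H2]; apply le_refl. Qed.

Lemma force_dia_bind a b W x Q :
  force (CDia a b) W x ->
  (forall V n e, le W V -> kid V x n = Some e -> agrees (force a) e ->
                 force b V (x ++ [n]) -> cover Q V) -> cover Q W.
Proof.
  intros H K. eapply cover_bind; [exact H|].
  intros V L (n & e & Hk & Ha & Hb). eauto.
Qed.

Lemma force_dia_unit a b W x n e :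
  kid W x n = Some e -> agrees (force a) e -> force b W (x ++ [n]) -> force (CDia a b) W x.
Proof.
  intros Hk Ha Hb. apply cover_unit. intros V L. exists n, e.
  split; [now apply L|]. split; [exact Ha|]. eapply force_le; eauto.
Qed.

Lemma force_or_l a b W x : force a W x -> force (Or a b) W x.
Proof. intros H. apply cover_unit. intros V L. left. eapply force_le; eauto. Qed.

Lemma force_or_r a b W x : force b W x -> force (Or a b) W x.
Proof. intros H. apply cover_unit. intros V L. right. eapply force_le; eauto. Qed.

Lemma force_top W x : force Top W x.
Proof. intros V L H. exact H. Qed.

(** All trees and paths are quantified over because the congruence rules need their premiss
    everywhere. *)
Lemma soundness phi : prov phi -> forall W x, force phi W x.
Proof.
  induction 1; intros W x.
  - intros V L Hp U L' _. eapply force_le; eauto.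
  - intros V L H1 U L1 H2 U' L2 H3.
    apply (H1 U' (le_trans _ _ _ L1 L2) H3 U' (le_refl _)). now apply H2.
  - intros V L []; auto.
  - intros V L []; auto.
  - intros V L Hp U L' Hq. split; auto. eapply force_le; eauto.
  - intros V L H. now apply force_or_l.
  - intros V L H. now apply force_or_r.
  - intros V L H1 U L1 H2 U' L2 H3. apply force_cover.
    eapply cover_bind; [exact H3|]. intros V' L3 H4. apply cover_unit. intros V2 L4.
    destruct H4 as [H4|H4]; (eapply force_le; [exact L4|]).
    + refine (H1 V' _ H4). eauto using le_trans.
    + refine (H2 V' _ H4). eauto using le_trans.
  - intros V L H. apply force_cover. eapply cover_bind; [exact H|]. contradiction.
  - exact (IHprov1 W x W (le_refl W) (IHprov2 W x)).
  (* [agrees] depends on a truth set only up to pointwise equivalence, so equivalent antecedents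
     select the same children. *)
  - assert (E := force_Iff _ _ IHprov).
    split; intros V L H1 U n e L' Hk Ha; apply H1 with e; auto;
      (eapply agrees_iff; [|exact Ha]); intros; split; apply E.
  - assert (E := force_Iff _ _ IHprov).
    split; intros V L H1 U n e L' Hk Ha; apply E; now apply H1 with e.
  - assert (E := force_Iff _ _ IHprov).
    split; intros V L H1; apply force_cover; apply (force_dia_bind _ _ _ _ _ H1);
      intros U n e L' Hk Ha Hb; apply cover_unit; intros U' L2; apply (force_le _ _ _ _ L2);
      apply force_dia_unit with n e; auto;
      (eapply agrees_iff; [|exact Ha]); intros; split; apply E.
  - assert (E := force_Iff _ _ IHprov).
    split; intros V L H1; apply force_cover; apply (force_dia_bind _ _ _ _ _ H1);
      intros U n e L' Hk Ha Hb; apply cover_unit; intros U' L2; apply (force_le _ _ _ _ L2);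
      apply force_dia_unit with n e; auto; now apply E.
  - intros V L H. split; intros U n e L' Hk Ha; now apply (H U n e).
  - intros V L [H1 H2] U n e L' Hk Ha. split; [apply H1 with e|apply H2 with e]; auto.
  - intros V n e L Hk Ha. apply force_top.
  - intros V L H. apply force_cover. eapply cover_bind; [exact H|].
    intros U L' HU. apply cover_unit. intros U' L2. apply (force_le _ _ _ _ L2).
    destruct HU as [HU|HU]; apply force_cover; apply (force_dia_bind _ _ _ _ _ HU);
      intros U2 n e L3 Hk Ha Hb; apply cover_unit; intros U3 L4; apply (force_le _ _ _ _ L4);
      apply force_dia_unit with n e; auto using force_or_l, force_or_r.
  - intros V L H. apply force_cover. apply (force_dia_bind _ _ _ _ _ H).
    (* The disjunction is covered at the child, but a cover concerns the whole tree, so the case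
       distinction can be made for [x] as well. *)
    intros U n e L' Hk Ha Hb. eapply cover_bind; [exact Hb|].
    intros U' L2 HU. apply cover_unit. intros U2 L3. apply (force_le _ _ _ _ L3).
    assert (kid U' x n = Some e) by now apply L2.
    destruct HU; [apply force_or_l|apply force_or_r]; now apply force_dia_unit with n e.
  - intros V L H. apply force_cover. apply (force_dia_bind _ _ _ _ _ H).
    intros U n e L' Hk Ha Hb. eapply cover_bind; [exact Hb|]. contradiction.
  - intros V L [H1 H2]. apply force_cover. apply (force_dia_bind _ _ _ _ _ H1).
    intros U n e L' Hk Ha Hb. apply cover_unit. intros U' L2. apply (force_le _ _ _ _ L2).
    apply force_dia_unit with n e; auto. split; [exact Hb|]. now apply H2 with e.
  - intros V L H U n e L' Hk Ha U' L2 Hq.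
    (* CFS: since [q] holds at child [n], this child witnesses the diamond conditional at [x]; the
       resulting box conditional is then used at the same child. *)
    assert (Hk' : kid U' x n = Some e) by now apply L2.
    apply (H U') with (V := U') (e := e); eauto using le_trans, le_refl.
    now apply force_dia_unit with n e.
Qed.

Lemma force_bigAnd l W x : (forall a, In a l -> force a W x) -> force (bigAnd l) W x.
Proof.
  induction l as [|a l IH]; intros H; [apply force_top|].
  destruct l as [|b l]; [apply H; now left|].
  split; [apply H; now left|]. apply IH. intros c Hc. apply H. now right.
Qed.

Theorem theorem3 (A : list formula) (phi : formula) :
  NoDup A -> derives A phi -> nder (map IIn A ++ [IOut phi]).
Proof.
  intros _ (l & Hl & D).
  (* In the one-node world with inputs [A], reflection forces all of [A], soundness forces [phi],
     and reifying [phi] at the root yields the desired sequent by computation. *)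
  apply (proj2 (reflect_reify phi) (Node A [] []) []); [reflexivity|now eexists|].
  apply (soundness _ D) with (W := Node A [] []); [apply le_refl|].
  apply force_bigAnd. intros a Ha. apply reflect_reify; [reflexivity|].
  apply real_in. now apply Hl.
Qed.
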